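(* Let $\mathcal C=\mathcal C_\pi$ be the continuous cluster category and let $\mathcal M$ be the topological space of isomorphism classes of its indecomposable objects. Every maximal compatible subset of $\mathcal M$ is closed in $\mathcal M$.
   Context: Let $S^1=\mathbb R/2\pi\mathbb Z$. Isomorphism classes of indecomposable objects of the continuous cluster category $\mathcal C$ (over a field $\mathbb k$) are represented by objects $E(x,y)$, $x<y<x+2\pi$, with $E(x,y)=E(x+2\pi,y+2\pi)$ and $E(x,y)\cong E(y,x+2\pi)$ and no other isomorphisms; so $\mathcal M$ is the set of unordered pairs of distinct points of $S^1$, with the quotient topology from $\{(x,y)\in S^1\times S^1:x\neq y\}$ (an open Moebius band). Morphisms: $\mathcal C(E(a,b),X)=\mathbb k$ if $X\cong E(x,y)$ for some $(x,y)\in[a,b)\times[b,a+2\pi)$, and $\mathcal C(E(a,b),X)=0$ for all other indecomposable $X$. Two indecomposables $X,Y$ are compatible if $\mathcal C(X,Y)=0$ or $\mathcal C(Y,X)=0$ or $X\cong Y$; equivalently, the geodesics in the disc model of the hyperbolic plane joining the corresponding pairs of points on the circle at infinity do not cross. A subset of $\mathcal M$ is compatible if its elements are pairwise compatible; it is maximal compatible if it is not properly contained in another compatible subset. *)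

(* Defs.v *)
From HB Require Import structures.
From mathcomp Require Import all_boot all_order all_algebra generic_quotient.
From mathcomp Require Import all_classical all_reals all_analysis.
From mathcomp Require Import lra.

Set Implicit Arguments.
Unset Strict Implicit.
Unset Printing Implicit Defensive.

Import Order.TTheory GRing.Theory Num.Theory.
Import numFieldTopology.Exports.

Local Open Scope classical_set_scope.
Local Open Scope ring_scope.
Local Open Scope quotient_scope.

Section Circle.
Variable R : realType.

Definition circle_rel (x y : R) : bool :=
  `[< exists n : int, y = x + n%:~R * (2 * pi) >].

Lemma circle_rel_equiv : equiv_class_of circle_rel.
Proof.
split.
- by move=> x; apply/asboolP; exists 0; rewrite mul0r addr0.
- move=> x y; apply/asboolP/asboolP => -[n ->]; exists (- n);
  by rewrite intrN mulNr addrK.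
- move=> y x z /asboolP[n ->] /asboolP[m ->]; apply/asboolP; exists (n + m).
  by rewrite intrD (mulrDl n%:~R) addrA.
Qed.

Canonical circle_equiv := EquivRelPack circle_rel_equiv.

Definition circle := quotient_topology {eq_quot circle_equiv}.
HB.instance Definition _ := Topological.on circle.

Definition to_circle (x : R) : circle := \pi_circle x.

(* Topologized as a subspace of circle * circle. *)
Definition config := set_type [set p : circle * circle | p.1 <> p.2].

Definition in_strip (x y : R) : Prop := x < y < x + 2 * pi.

Lemma ex_config_lift (p : config) : exists xy : R * R,
  [/\ in_strip xy.1 xy.2, to_circle xy.1 = (set_val p).1
    & to_circle xy.2 = (set_val p).2].
Proof.
case: p => -[s t] /= st.
have {st} : s <> t by rewrite inE in st.
pose x := repr s; pose y := repr t => st.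
have sE : to_circle x = s by rewrite /to_circle reprK.
have tE : to_circle y = t by rewrite /to_circle reprK.
have p0 : 0 < 2 * pi :> R by rewrite mulr_gt0// pi_gt0.
pose n := Num.floor ((y - x) / (2 * pi)).
pose y' := y - n%:~R * (2 * pi).
have y'E : to_circle y' = t.
  rewrite -tE; apply/eqmodP/asboolP; exists n.
  by rewrite /y' addrNK.
exists (x, y'); split=> //=; rewrite /in_strip.
have xy' : x != y' by apply: contra_notN st => /eqP xy; rewrite -sE -y'E xy.
rewrite lt_neqAle xy'/= /y' lerBrDr -lerBrDl -ler_pdivlMr// floor_le/=.
have := floorD1_gt ((y - x) / (2 * pi)).
by rewrite ltr_pdivrMr// -/n intrD (mulrDl n%:~R) mul1r; lra.
Qed.

Definition config_lift (p : config) : R * R := projT1 (cid (ex_config_lift p)).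

Lemma config_lift_in_strip (p : config) :
  in_strip (config_lift p).1 (config_lift p).2.
Proof. by rewrite /config_lift; case: cid => /= xy []. Qed.

End Circle.

Section LinearCategory.
Variable k : fieldType.

Record linear_category := LinearCategory {
  obj :> Type;
  hom : obj -> obj -> lmodType k;
  idm : forall X, hom X X;
  hcomp : forall X Y Z, hom Y Z -> hom X Y -> hom X Z;
  hcomp_idl : forall X Y (f : hom X Y), hcomp (idm Y) f = f;
  hcomp_idr : forall X Y (f : hom X Y), hcomp f (idm X) = f;
  hcompA : forall X Y Z W (h : hom Z W) (g : hom Y Z) (f : hom X Y),
    hcomp h (hcomp g f) = hcomp (hcomp h g) f;
  hcomp_linearl : forall X Y Z (c : k) (g g' : hom Y Z) (f : hom X Y),
    hcomp (c *: g + g') f = c *: hcomp g f + hcomp g' f;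
  hcomp_linearr : forall X Y Z (c : k) (g : hom Y Z) (f f' : hom X Y),
    hcomp g (c *: f + f') = c *: hcomp g f + hcomp g f' }.

Variable C : linear_category.

Definition isomorphic (X Y : C) : Prop :=
  exists (f : hom X Y) (g : hom Y X), hcomp g f = idm X /\ hcomp f g = idm Y.

Definition zero_object (X : C) : Prop := idm X = 0.

Definition direct_sum (X A B : C) : Prop :=
  exists (i : hom A X) (p : hom X A) (j : hom B X) (q : hom X B),
    [/\ hcomp p i = idm A, hcomp q j = idm B, hcomp p j = 0, hcomp q i = 0
      & hcomp i p + hcomp j q = idm X].

Definition indecomposable (X : C) : Prop :=
  ~ zero_object X /\
  forall A B : C, direct_sum X A B -> zero_object A \/ zero_object B.

Definition hom_zero (X Y : C) : Prop := forall f : hom X Y, f = 0.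

Definition hom_line (X Y : C) : Prop :=
  exists phi : {linear k^o -> hom X Y}, bijective phi.

Definition indec : Type := {X : C | indecomposable X}.
HB.instance Definition _ := gen_eqMixin indec.
HB.instance Definition _ := gen_choiceMixin indec.

Definition indec_iso (X Y : indec) : bool := `[< isomorphic (sval X) (sval Y) >].

Lemma indec_iso_equiv : equiv_class_of indec_iso.
Proof.
split.
- move=> X; apply/asboolP; exists (idm (sval X)), (idm (sval X)).
  by rewrite hcomp_idl.
- by move=> X Y; apply/asboolP/asboolP => -[f [g [gf fg]]]; exists g, f.
- move=> Y X Z /asboolP[f [f' [f'f ff']]] /asboolP[g [g' [g'g gg']]].
  apply/asboolP; exists (hcomp g f), (hcomp f' g'); split.
    by rewrite hcompA -(hcompA f') g'g hcomp_idr.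
  by rewrite hcompA -(hcompA g) ff' hcomp_idr.
Qed.

Canonical indec_iso_equivr := EquivRelPack indec_iso_equiv.

Definition isoclasses := {eq_quot indec_iso_equivr}.

Definition isoclass (X : C) (iX : indecomposable X) : isoclasses :=
  \pi_isoclasses (exist _ X iX).

End LinearCategory.

(* The continuous cluster category, through its indecomposable objects and the
   morphisms between them.  E x y is only meaningful on the strip
   x < y < x + 2 pi.  The existence of direct sums and the triangulation are
   not recorded: isomorphism classes of indecomposable objects, their topology
   and compatibility do not depend on them, so a result for every such
   structure holds in particular for the triangulated category. *)
Record continuous_cluster_category (R : realType) (k : fieldType) :=
  ContinuousClusterCategory {
  ccc_cat :> linear_category k;
  E : R -> R -> ccc_cat;
  E_indec : forall x y, in_strip x y -> indecomposable (E x y);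
  E_surj : forall X : ccc_cat, indecomposable X ->
    exists x y, in_strip x y /\ isomorphic X (E x y);
  E_period : forall x y, in_strip x y -> E (x + 2 * pi) (y + 2 * pi) = E x y;
  (* (x', y') is in the orbit of (x, y) under (x, y) |-> (y, x + 2 pi) *)
  E_iso : forall x y x' y', in_strip x y -> in_strip x' y' ->
    isomorphic (E x y) (E x' y') <->
    exists n : int,
      (x' = x + n%:~R * (2 * pi) /\ y' = y + n%:~R * (2 * pi)) \/
      (x' = y + n%:~R * (2 * pi) /\ y' = x + (n + 1)%:~R * (2 * pi));
  hom_E_line : forall a b (X : ccc_cat), in_strip a b -> indecomposable X ->
    (exists x y, [/\ a <= x < b, b <= y < a + 2 * pi & isomorphic X (E x y)]) ->
    hom_line (E a b) X;
  hom_E_zero : forall a b (X : ccc_cat), in_strip a b -> indecomposable X ->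
    ~ (exists x y, [/\ a <= x < b, b <= y < a + 2 * pi & isomorphic X (E x y)]) ->
    hom_zero (E a b) X }.

Section Moduli.
Variables (R : realType) (k : fieldType) (C : continuous_cluster_category R k).

Definition moduli : Type := isoclasses C.
HB.instance Definition _ := Choice.on moduli.

(* Sends a pair of distinct points of the circle to the class of E x y for
   lifts x < y < x + 2 pi; by E_period/E_iso the choice of lifts is irrelevant
   and two pairs have the same image iff they are equal up to order.
   The topology of moduli is the quotient topology along this map. *)
Definition moduli_of_config (p : config R) : moduli :=
  isoclass (E_indec C (config_lift_in_strip p)).

Definition moduli_open (U : set moduli) : Prop :=
  open (moduli_of_config @^-1` U).

Lemma moduli_openT : moduli_open setT.
Proof. by rewrite /moduli_open preimage_setT; exact: openT. Qed.

Lemma moduli_openI : setI_closed moduli_open.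
Proof. by move=> U V oU oV; exact: openI. Qed.

Lemma moduli_open_bigU (I : Type) (f : I -> set moduli) :
  (forall i, moduli_open (f i)) -> moduli_open (\bigcup_i f i).
Proof. by move=> of_; apply: bigcup_open => i _; exact: of_. Qed.

HB.instance Definition _ := isOpenTopological.Build moduli
  moduli_openT moduli_openI moduli_open_bigU.

Definition compatible_obj (X Y : C) : Prop :=
  [\/ hom_zero X Y, hom_zero Y X | isomorphic X Y].

(* compatible_obj is invariant under isomorphism, so the choice of
   representatives does not matter *)
Definition compatible (m n : moduli) : Prop :=
  compatible_obj (sval (repr (m : isoclasses C)))
    (sval (repr (n : isoclasses C))).

Definition compatible_set (A : set moduli) : Prop :=
  forall m n, A m -> A n -> compatible m n.

Definition maximal_compatible (A : set moduli) : Prop :=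
  compatible_set A /\ ~ exists B, compatible_set B /\ A `<` B.

End Moduli.

(* Main.v *)
(** Two indecomposables are incompatible exactly when their endpoints strictly
    interleave on the circle.  Strict interleaving is an open condition, because
    the covering [R -> circle] is an open map; hence the set of objects
    compatible with a fixed one is closed.  By maximality, [A] is the
    intersection of these closed sets over its elements. *)

Require Import Defs.
From mathcomp Require Import all_boot all_order all_algebra generic_quotient.
From mathcomp Require Import all_classical all_reals all_analysis.
From mathcomp Require Import lra.

Set Implicit Arguments.
Unset Strict Implicit.
Unset Printing Implicit Defensive.

Import Order.TTheory GRing.Theory Num.Theory.
Import numFieldTopology.Exports numFieldNormedType.Exports.
Local Open Scope classical_set_scope.
Local Open Scope ring_scope.
Local Open Scope quotient_scope.

(** * Zero morphism spaces and isomorphism *)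

Section LinearCategoryTheory.
Variables (k : fieldType) (C : linear_category k).

Lemma isomorphic_refl (X : C) : isomorphic X X.
Proof. by exists (idm X), (idm X); rewrite hcomp_idl. Qed.

Lemma isomorphic_sym (X Y : C) : isomorphic X Y -> isomorphic Y X.
Proof. by move=> [f [g [gf fg]]]; exists g, f. Qed.

Lemma isomorphic_trans (Y X Z : C) :
  isomorphic X Y -> isomorphic Y Z -> isomorphic X Z.
Proof.
move=> [f [f' [f'f ff']]] [g [g' [g'g gg']]].
exists (hcomp g f), (hcomp f' g'); split.
  by rewrite hcompA -(hcompA f') g'g hcomp_idr.
by rewrite hcompA -(hcompA g) ff' hcomp_idr.
Qed.

Lemma hcomp0r (X Y Z : C) (g : Defs.hom Y Z) :
  hcomp g (0 : Defs.hom X Y) = 0.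
Proof.
have := hcomp_linearr (-1) g (0 : Defs.hom X Y) 0.
by rewrite !scaleN1r !addNr.
Qed.

Lemma hcomp0l (X Y Z : C) (f : Defs.hom X Y) :
  hcomp (0 : Defs.hom Y Z) f = 0.
Proof.
have := hcomp_linearl (-1) (0 : Defs.hom Y Z) 0 f.
by rewrite !scaleN1r !addNr.
Qed.

(** Any [h] from [X'] to [Y'] factors through the composite of [f], [h] and [g'], a map from [X] to
    [Y], which vanishes. *)
Lemma hom_zero_iso (X X' Y Y' : C) :
  isomorphic X X' -> isomorphic Y Y' -> hom_zero X Y -> hom_zero X' Y'.
Proof.
move=> [f [f' [_ ff']]] [g [g' [_ gg']]] XY h.
have -> : h = hcomp (hcomp g (hcomp g' (hcomp h f))) f'.
  by rewrite !hcompA gg' hcomp_idl -hcompA ff' hcomp_idr.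
by rewrite (XY (hcomp g' (hcomp h f))) hcomp0r hcomp0l.
Qed.

Lemma hom_line_nonzero (X Y : C) : hom_line X Y -> ~ hom_zero X Y.
Proof.
move=> [phi /bij_inj phi_inj] XY0.
have /phi_inj/eqP : phi 1 = phi 0 by rewrite (XY0 (phi 1)) (XY0 (phi 0)).
by rewrite oner_eq0.
Qed.

Lemma isomorphic_repr_isoclass (X : C) (iX : indecomposable X) :
  isomorphic (sval (repr (isoclass iX))) X.
Proof. by have /eqmodP/asboolP := reprK (isoclass iX). Qed.
End LinearCategoryTheory.

(** * Open sets of the circle and lifts to the line *)

Section CircleTheory.
Variable R : realType.

Lemma to_circleP (x y : R) :
  to_circle x = to_circle y <-> exists n : int, y = x + n%:~R * (2 * pi).
Proof. by split=> [/eqmodP/asboolP|?]; last by apply/eqmodP/asboolP. Qed.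

(** In the quotient topology it suffices that the preimage of the image is open; this preimage is
    the union of the translates of [U] by all multiples of the period. *)
Lemma to_circle_open (U : set R) : open U -> open (@to_circle R @` U).
Proof.
move=> oU.
have oV : open (\bigcup_(n in [set: int])
    ((fun x : R => x + n%:~R * (2 * pi)) @^-1` U)).
  apply: bigcup_open => n _; apply: open_comp => // x _.
  by apply: cvgD; [exact: cvg_id|exact: cvg_cst].
rewrite /open/= /quotient_open.
suff -> : \pi_(circle R) @^-1` (@to_circle R @` U) =
  \bigcup_(n in [set: int]) ((fun x : R => x + n%:~R * (2 * pi)) @^-1` U) by [].
apply/seteqP; split=> x /=.
  by move=> [u Uu /esym/to_circleP[n un]]; exists n => //=; rewrite -un.
move=> [n _ /= Un]; exists (x + n%:~R * (2 * pi)) => //.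
by apply/esym/to_circleP; exists n.
Qed.

Lemma config_open_setX (U V : set (circle R)) : open U -> open V ->
  open [set p : config R | U (set_val p).1 /\ V (set_val p).2].
Proof.
move=> oU oV.
have cval : continuous (set_val : config R -> circle R * circle R).
  exact: initial_continuous.
have /continuousP cfst : continuous (fun p : config R => (set_val p).1 : circle R).
  by move=> p; apply: cvg_comp; [exact: cval|exact: cvg_fst].
have /continuousP csnd : continuous (fun p : config R => (set_val p).2 : circle R).
  by move=> p; apply: cvg_comp; [exact: cval|exact: cvg_snd].
by apply: openI; [exact: cfst|exact: csnd].
Qed.

Lemma to_circle_config_lift (p : config R) :
  to_circle (config_lift p).1 = (set_val p).1 /\
  to_circle (config_lift p).2 = (set_val p).2.
Proof. by rewrite /config_lift; case: cid => /= xy []. Qed.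

Lemma period_gt0 : 0 < 2 * pi :> R.
Proof. by rewrite mulr_gt0// pi_gt0. Qed.

(** Turns strict inequalities between lifts into the vanishing of the integer shift between them. *)
Lemma int_mul_small (n : int) (P : R) : 0 < P ->
  - P < n%:~R * P -> n%:~R * P < P -> n = 0.
Proof.
move=> P0 nP Pn.
have : (- 1)%:~R < n%:~R :> R by rewrite -(ltr_pM2r P0) intrN mulN1r.
have : n%:~R < 1%:~R :> R by rewrite -(ltr_pM2r P0) mul1r.
by rewrite !ltr_int; move: n {nP Pn} => [[|n]|[|n]].
Qed.
End CircleTheory.

(** * Incompatibility as crossing, and closedness *)

Section ContinuousClusterCategory.
Variables (R : realType) (k : fieldType) (C : continuous_cluster_category R k).
Implicit Types a b x y : R.

Lemma isomorphic_E_circle x y x' y' : in_strip x y -> in_strip x' y' ->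
  isomorphic (E C x y) (E C x' y') <->
  (to_circle x = to_circle x' /\ to_circle y = to_circle y') \/
  (to_circle x = to_circle y' /\ to_circle y = to_circle x').
Proof.
move=> xy xy'; rewrite E_iso//; have P0 := period_gt0 R.
move: xy xy'; rewrite /in_strip => /andP[xy yx] /andP[xy' yx'].
split=> [[n [[-> ->]|[-> ->]]]|].
- by left; split; apply/to_circleP; exists n.
- by right; split; apply/to_circleP; [exists (n + 1)|exists n].
move=> [[/to_circleP[n xn] /to_circleP[m ym]]|].
  (* The two endpoints have a priori different shifts; [y - x] and [y' - x'] both lie strictly
     between 0 and one period, which forces the shifts to agree. *)
  have /eqP : m - n = 0.
    by apply: (int_mul_small P0); rewrite intrB mulrBl; lra.
  by rewrite subr_eq0 => /eqP mn; exists n; left; rewrite xn ym mn.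
move=> [/to_circleP[n yn] /to_circleP[m xm]].
(* Here [(y' - x') + (y - x)] equals [n - m] periods and lies strictly between 0 and two periods. *)
have /eqP : n - (m + 1) = 0.
  by apply: (int_mul_small P0); rewrite !(intrB, intrD) !(mulrBl, mulrDl) mul1r; lra.
by rewrite subr_eq0 => /eqP mn; exists m; right; rewrite xm yn mn.
Qed.

(** The interior of the half-open rectangle that supports the morphisms out of [E a b];
    geometrically, the two geodesics cross. *)
Definition crossing a b x y := a < x < b /\ b < y < a + 2 * pi.

Lemma crossing_in_strip a b x y : crossing a b x y -> in_strip x y.
Proof.
by move=> [/andP[? ?] /andP[? ?]]; apply/andP; split; lra.
Qed.

Lemma compatible_obj_sym (X Y : C) :
  compatible_obj X Y -> compatible_obj Y X.
Proof.
by case=> [| |/isomorphic_sym] ?; [apply: Or32|apply: Or31|apply: Or33].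
Qed.

Lemma compatible_obj_iso (X X' Y Y' : C) : isomorphic X X' -> isomorphic Y Y' ->
  compatible_obj X Y -> compatible_obj X' Y'.
Proof.
move=> XX' YY' [XY|YX|XY].
- by apply: Or31; exact: hom_zero_iso XY.
- by apply: Or32; exact: hom_zero_iso YX.
- apply: Or33; apply: isomorphic_trans YY'.
  by apply: isomorphic_trans XY; exact: isomorphic_sym.
Qed.

Lemma crossing_incompatible a b x y : in_strip a b -> crossing a b x y ->
  ~ compatible_obj (E C a b) (E C x y).
Proof.
move=> ab abxy; have xy := crossing_in_strip abxy; have P0 := period_gt0 R.
have ba : in_strip b (a + 2 * pi).
  by move: ab => /andP[? ?]; apply/andP; split; lra.
have swap : isomorphic (E C a b) (E C b (a + 2 * pi)).
  by apply/E_iso => //; exists 0; right; rewrite add0r !mul0r mul1r addr0.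
move: (ab) (abxy) => /andP[ab1 ab2] [/andP[ax xb] /andP[by_ ya]].
case.
- apply: hom_line_nonzero; apply: hom_E_line => //; first exact: E_indec.
  exists x, y; split; [by apply/andP; split; lra..|exact: isomorphic_refl].
- apply: hom_line_nonzero; apply: hom_E_line => //; first exact: E_indec.
  (* The pair [(a, b)] itself misses the rectangle of [(x, y)], but the swapped lift of the same
     object lies in it. *)
  exists b, (a + 2 * pi); split=> //; by apply/andP; split; lra.
- move=> /(E_iso C ab xy)[n []].
  + move=> [xn yn].
    have n0 : n = 0 by apply: (int_mul_small P0); lra.
    by move: xn; rewrite n0 mul0r; lra.
  + rewrite intrD mulrDl mul1r => -[xn yn].
    have n0 : n = 0 by apply: (int_mul_small P0); lra.
    by move: xn; rewrite n0 mul0r; lra.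
Qed.

Lemma incompatible_crossing a b x y : in_strip a b -> in_strip x y ->
  ~ compatible_obj (E C a b) (E C x y) ->
  exists x' y', crossing a b x' y' /\ isomorphic (E C x y) (E C x' y').
Proof.
move=> ab xy inc; have P0 := period_gt0 R.
(* A nonzero map in each direction already makes all inequalities strict,
   except when the two objects are isomorphic. *)
have [x' [y' [/andP[ax xb] /andP[by_ ya] xyx'y']]] : exists x' y',
    [/\ a <= x' < b, b <= y' < a + 2 * pi & isomorphic (E C x y) (E C x' y')].
  apply: contrapT => none; apply: inc; apply: Or31.
  by apply: hom_E_zero => //; exact: E_indec.
have xy' : in_strip x' y' by apply/andP; split; lra.
(* The reverse morphisms are taken out of the lift [(x', y')], so that both rectangles share one set
   of coordinates. *)
have [a' [b' [/andP[xa ay] /andP[yb bx] aba'b']]] : exists a' b',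
    [/\ x' <= a' < y', y' <= b' < x' + 2 * pi & isomorphic (E C a b) (E C a' b')].
  apply: contrapT => none; apply: inc; apply: Or32.
  apply: (@hom_zero_iso _ C (E C x' y') _ (E C a b)).
  - exact: isomorphic_sym.
  - exact: isomorphic_refl.
  - by apply: hom_E_zero => //; exact: E_indec.
have ab' : in_strip a' b' by apply/andP; split; lra.
exists x', y'; split => //; move: (ab) => /andP[ab1 ab2].
(* If the second lift is a translate of [(a, b)], both rectangles squeeze [(x', y')] onto [(a, b)],
   and the objects would be isomorphic. *)
move: aba'b' => /(E_iso C ab ab')[n []] [an bn].
  have n0 : n = 0 by apply: (int_mul_small P0); lra.
  have ax' : a = x' by move: an; rewrite n0 mul0r; lra.
  have by' : b = y' by move: bn; rewrite n0 mul0r; lra.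
  exfalso; apply: inc; apply: Or33; rewrite ax' by'.
  exact: isomorphic_sym.
(* Otherwise the second lift is [(b, a + 2 * pi)]; its strict bounds supply the missing [a < x'] and
   [b < y']. *)
move: bn; rewrite intrD mulrDl mul1r => bn.
have n0 : n = 0 by apply: (int_mul_small P0); lra.
move: an bn; rewrite n0 mul0r => an bn.
by split; apply/andP; split; lra.
Qed.

Lemma moduli_strip (m : moduli C) : exists a b,
  in_strip a b /\ isomorphic (sval (repr (m : isoclasses C))) (E C a b).
Proof. by apply: E_surj; exact: svalP. Qed.

(** The endpoints of [m] cut the circle into open arcs [U] and [V]; incompatibility with [m] means
    having one endpoint in each. *)
Lemma closed_compatible (m : moduli C) : closed [set n | compatible m n].
Proof.
have [a [b [ab ma]]] := moduli_strip m.
pose U := @to_circle R @` `]a, b[; pose V := @to_circle R @` `]b, a + 2 * pi[.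
have oU : open U by apply: to_circle_open; exact: interval_open.
have oV : open V by apply: to_circle_open; exact: interval_open.
rewrite -openC.
(* Openness in [moduli] is by definition openness of the preimage among ordered pairs, hence the two
   orders of [U] and [V] below. *)
change (open (@moduli_of_config R k C @^-1` (~` [set n | compatible m n]))).
suff -> : @moduli_of_config R k C @^-1` (~` [set n | compatible m n]) =
  [set p | U (set_val p).1 /\ V (set_val p).2] `|`
  [set p | V (set_val p).1 /\ U (set_val p).2].
  by apply: openU; exact: config_open_setX.
apply/funext => p; apply/propext => /=.
have [p1 p2] := to_circle_config_lift p.
have xy := config_lift_in_strip p.
have iso_xy : isomorphic (sval (repr (moduli_of_config C p : isoclasses C)))
    (E C (config_lift p).1 (config_lift p).2).
  exact: isomorphic_repr_isoclass.
move: (config_lift p) p1 p2 xy iso_xy => [x y] /= p1 p2 xy iso_xy.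
(* Isomorphism invariance replaces the chosen representatives by objects [E]. *)
have compE : compatible m (moduli_of_config C p) <->
    compatible_obj (E C a b) (E C x y).
  by split; apply: compatible_obj_iso => //; exact: isomorphic_sym.
split.
  move=> /compE/(incompatible_crossing ab xy)[x' [y' [abxy]]].
  have xy' := crossing_in_strip abxy.
  have Ux' : U (to_circle x') by exists x' => //=; rewrite in_itv/=; case: abxy.
  have Vy' : V (to_circle y') by exists y' => //=; rewrite in_itv/=; case: abxy.
  move=> /(isomorphic_E_circle xy xy')[] [xx' yy'].
    by left; rewrite -p1 -p2 xx' yy'.
  by right; rewrite -p1 -p2 xx' yy'.
have cross x' y' : x' \in `]a, b[ -> y' \in `]b, a + 2 * pi[ ->
    (to_circle x = to_circle x' /\ to_circle y = to_circle y') \/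
    (to_circle x = to_circle y' /\ to_circle y = to_circle x') ->
    ~ compatible m (moduli_of_config C p).
  rewrite !in_itv/= => abx bay; have abxy : crossing a b x' y' by [].
  move=> /(isomorphic_E_circle xy (crossing_in_strip abxy)) iso' /compE comp.
  apply: (crossing_incompatible ab abxy).
  exact: compatible_obj_iso (isomorphic_refl _) iso' comp.
move=> [] [[x' Ux' x'E] [y' Vy' y'E]].
  by apply: cross Ux' Vy' _; left; rewrite p1 p2.
by apply: cross Vy' Ux' _; right; rewrite p1 p2.
Qed.


End ContinuousClusterCategory.

Theorem proposition3p2p1 (R : realType) (k : fieldType)
    (C : continuous_cluster_category R k) (A : set (moduli C)) :
  maximal_compatible A -> closed A.
Proof.
move=> [cA maxA].
suff -> : A = \bigcap_(m in A) [set n | compatible m n].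
  by apply: closed_bigI => m _; exact: closed_compatible.
apply/seteqP; split=> [n An m Am|n nA]; first exact: cA.
(* Adjoining [n] keeps [A] compatible: mixed pairs use the choice of [n] and symmetry, and [n] is
   isomorphic to itself. *)
apply: contrapT => nAn; apply: maxA; exists (A `|` [set n]); split.
  move=> u v [Au|->] [Av|->]; [exact: cA|exact: nA| |].
    by apply: compatible_obj_sym; exact: nA.
  by apply: Or33; exact: isomorphic_refl.
by split=> [u Au|/(_ n)]; [left|move=> H; apply: nAn; apply: H; right].
Qed.
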